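(* Every root of unity belongs to $\mathcal{F}_2$. Moreover, if $\alpha\in\mathcal{F}_2$, then either all conjugates of $\alpha$ have modulus $1$, or $\alpha$ is an expanding algebraic integer with $|M_\alpha(0)|=2$.
   Context: For $S\subset\mathbb{C}$ and $\alpha\in\mathbb{C}$, $S[\alpha]:=\{\sum_{j=0}^n f_j\alpha^j : n\in\mathbb{N},\ (f_0,\ldots,f_n)\in S^{n+1}\}$. For an algebraic number $\alpha$, $M_\alpha\in\mathbb{Z}[x]$ is its primitive minimal polynomial over $\mathbb{Q}$ (integer coefficients with gcd $1$); conjugates are over $\mathbb{Q}$ and include $\alpha$. For an algebraic number $\alpha$ for which some finite $S\subset\mathbb{C}$ satisfies $\mathbb{Z}[\alpha]=S[\alpha]$, let $S_\alpha$ denote such a finite set of minimal cardinality; for $N\in\mathbb{N}$, $\mathcal{F}_N$ is the set of algebraic numbers $\alpha$ for which such a set exists and $\operatorname{Card}(S_\alpha)=N$. An expanding algebraic integer is an algebraic integer all of whose conjugates have modulus greater than $1$. *)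

(* Defs.v *)
From HB Require Import structures.
From mathcomp Require Import all_boot all_order all_algebra.
From mathcomp Require Import all_classical all_reals.
From mathcomp Require Import complex.

Set Implicit Arguments.
Unset Strict Implicit.
Unset Printing Implicit Defensive.

Import Order.TTheory GRing.Theory Num.Theory.
Local Open Scope classical_set_scope.
Local Open Scope ring_scope.
Local Open Scope complex_scope.

(* The field of complex numbers is R[i] for an arbitrary R : realType; the
   norm of R[i] takes its (real, nonnegative) values in R[i] itself. *)

(* S[alpha]; the sums have at least one term (n = 0 is allowed). *)
Definition adjoin_set (R : realType) (S : set R[i]) (alpha : R[i]) : set R[i] :=
  [set z | exists n (f : 'I_n.+1 -> R[i]),
     (forall j, S (f j)) /\ z = \sum_(j < n.+1) f j * alpha ^+ j].

Definition int_set (R : realType) : set R[i] := range (fun m : int => m%:~R).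

Definition algebraic_number (R : realType) (alpha : R[i]) : Prop :=
  algebraicOver (ratr : rat -> R[i]) alpha.

Definition algebraic_integer (R : realType) (alpha : R[i]) : Prop :=
  integralOver (intr : int -> R[i]) alpha.

(* M is a polynomial of least degree among the nonzero rational polynomials
   vanishing at alpha. The condition [zcontents M = 1] says that the gcd of the
   coefficients is 1 and the leading coefficient is positive; in particular
   M != 0. *)
Definition is_primitive_minpoly (R : realType) (alpha : R[i]) (M : {poly int})
    : Prop :=
  [/\ zcontents M = 1,
      root (map_poly (intr : int -> R[i]) M) alpha
    & forall p : {poly rat}, p != 0 ->
        root (map_poly (ratr : rat -> R[i]) p) alpha -> (size M <= size p)%N].

(* Meaningful for algebraic alpha only; see primitive_minpolyP. *)
Definition primitive_minpoly (R : realType) (alpha : R[i]) : {poly int} :=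
  xget 0 [set M | is_primitive_minpoly alpha M].

Definition conjugates (R : realType) (alpha : R[i]) : set R[i] :=
  [set beta | root (map_poly (intr : int -> R[i]) (primitive_minpoly alpha))
                   beta].

Definition expanding_algebraic_integer (R : realType) (alpha : R[i]) : Prop :=
  algebraic_integer alpha /\
  forall beta, conjugates alpha beta -> 1 < `|beta|.

Definition represents (R : realType) (S : set R[i]) (alpha : R[i]) : Prop :=
  adjoin_set (@int_set R) alpha = adjoin_set S alpha.

Definition FN (R : realType) (N : nat) : set R[i] :=
  [set alpha | [/\ algebraic_number alpha,
     exists S : set R[i], (S #= `I_N)%card /\ represents S alpha
   & forall (S : set R[i]) (k : nat),
       (S #= `I_k)%card -> represents S alpha -> (N <= k)%N]].

Definition is_root_of_unity (R : realType) (alpha : R[i]) : Prop :=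
  exists2 n : nat, (0 < n)%N & n.-unity_root alpha.

Lemma map_ratr_intr (R : realType) (q : {poly int}) :
  map_poly (ratr : rat -> R[i]) (map_poly intr q) = map_poly intr q.
Proof.
by apply/polyP => i; rewrite !coef_map_id0 ?ratr_int ?rmorph0.
Qed.

Lemma primitive_minpolyP (R : realType) (alpha : R[i]) :
  algebraic_number alpha ->
  is_primitive_minpoly alpha (primitive_minpoly alpha).
Proof.
case=> p0 p0n0 p0r; apply: xgetPex => /=.
pose P (n : nat) := `[< exists p : {poly rat}, [/\ p != 0,
  root (map_poly (ratr : rat -> R[i]) p) alpha & size p = n] >].
have exP : exists n, P n by exists (size p0); apply/asboolP; exists p0.
have [n /asboolP[p [pn0 pr sp]] nmin] := ex_minnP exP.
have [q [a a0 pE]] := rat_poly_scale p.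
have aQ0 : (a%:~R^-1 : rat) != 0 by rewrite invr_eq0 intr_eq0.
have qn0 : q != 0.
  by apply: contraNneq pn0 => q0; rewrite pE q0 map_poly0 scaler0.
exists (zprimitive q); split.
- by rewrite zcontents_primitive qn0.
- have : root (map_poly (intr : int -> R[i]) q) alpha.
    move: pr; rewrite pE map_polyZ rootZ ?map_ratr_intr //.
    by rewrite fmorph_eq0.
  rewrite {1}[q]zpolyEprim map_polyZ rootZ //.
  by rewrite intr_eq0 zcontents_eq0.
- move=> p' p'n0 p'r; rewrite size_zprimitive.
  have -> : size q = n.
    rewrite -sp pE size_scale // size_map_inj_poly //; exact: intr_inj.
  by apply: nmin; apply/asboolP; exists p'.
Qed.

(* Main.v *)
Require Import Defs.
From mathcomp Require Import all_boot all_order all_algebra.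
From mathcomp Require Import all_classical all_reals.
From mathcomp Require Import complex.
Import Order.TTheory GRing.Theory Num.Theory.
Local Open Scope classical_set_scope.
Local Open Scope ring_scope.
Local Open Scope complex_scope.

(** If alpha != 1 is a root of unity then 1 + alpha + ... + alpha^(n-1) = 0, so
    every -alpha^j is a sum of powers of alpha, and since powers may be moved to
    arbitrarily high exponents, Z[alpha] = {0,1}[alpha]; for alpha = 1 the digits
    {1,-1} work. One digit s only yields s(alpha^m - 1)/(alpha - 1), a bounded
    family, or for alpha = 1 the multiples m s with m > 0, which do not contain
    both 0 and 1.

    Conversely let Z[alpha] = S[alpha] with S = {a,b}. A conjugate beta with
    |beta| < 1 would bound the image of S[alpha] under alpha |-> beta, hence all
    integers; so every conjugate has modulus at least 1. As Z[alpha] is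
    S + alpha Z[alpha], the quotient Z[alpha]/(alpha) = Z/M(0) has at most two
    elements. If some |beta| = 1, then 1/beta is the complex conjugate of beta,
    so by irreducibility of M the conjugates are stable under inversion and all
    have modulus 1. Otherwise |M(0)| exceeds the leading coefficient of M, which
    forces |M(0)| = 2 and M monic. *)

Section Theorem2.
Variable R : realType.
Implicit Types (alpha beta gamma z s : R[i]) (S : set R[i]) (p : {poly int}).

Local Notation ZC := (map_poly (intr : int -> R[i])).
Local Notation QC := (map_poly (ratr : rat -> R[i])).
Local Notation ZQ := (map_poly (intr : int -> rat)).

(** * Archimedean bounds in [R[i]] *)

Lemma exists_nat_gt (x : R[i]) : 0 <= x -> exists k : nat, x < k%:R.
Proof.
move=> x0; exists (Num.bound (complex.Re x)).
have xE : x = (complex.Re x)%:C by move: (ger0_Im x0); case: x {x0} => a b /= ->.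
have r0 : 0 <= complex.Re x by move: x0; rewrite {1}xE -[0]/(0%:C) lecR.
by rewrite {1}xE -(rmorph_nat (real_complex R)) ltcR archi_boundP.
Qed.

Lemma exists_nat_mul_gt (x y : R[i]) :
  0 < x -> 0 <= y -> exists k : nat, y < k%:R * x.
Proof.
move=> x0 y0; have /exists_nat_gt [k hk] : 0 <= y / x by rewrite divr_ge0 // ltW.
by exists k; rewrite -ltr_pdivrMr.
Qed.

(** * Digit expansions *)

Lemma adjoin_setP S alpha z : adjoin_set S alpha z <->
  exists n (f : nat -> R[i]), (forall j, (j < n.+1)%N -> S (f j)) /\
    z = \sum_(0 <= j < n.+1) f j * alpha ^+ j.
Proof.
split=> [[n [f [fS ->]]]|[n [f [fS ->]]]].
  exists n, (fun j => f (inord j)); split=> [j _|]; first exact: fS.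
  by rewrite big_mkord; apply: eq_bigr => j _; rewrite inord_val.
exists n, (fun j => f j); split=> [j|]; first exact: fS.
by rewrite big_mkord.
Qed.

Lemma adjoin_int_setP alpha z :
  adjoin_set (@int_set R) alpha z <-> exists p, z = (ZC p).[alpha].
Proof.
split=> [[n [f [fZ ->]]]|[p ->]].
  have [g gE] : {g : 'I_n.+1 -> int & forall j, f j = (g j)%:~R}.
    apply: (@choice _ _ (fun j m => f j = m%:~R)) => j.
    by case: (fZ j) => m _ <-; exists m.
  exists (\sum_(j < n.+1) (g j) *: 'X^j).
  rewrite rmorph_sum /= horner_sum; apply: eq_bigr => j _.
  by rewrite gE map_polyZ /= map_polyXn hornerZ hornerXn.
apply/adjoin_setP; exists (size p), (fun j => (p`_j)%:~R); split=> [j _|].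
  by exists p`_j.
rewrite (@horner_coef_wide _ (size p).+1); last first.
  by rewrite (leq_trans (size_poly _ _)).
by rewrite big_mkord; apply: eq_bigr => j _; rewrite coef_map.
Qed.

Lemma adjoin_set_const S alpha s : S s -> adjoin_set S alpha s.
Proof.
by move=> Ss; exists 0%N, (fun=> s); split=> //; rewrite big_ord1 mulr1.
Qed.

(** As an additive group, [Z[alpha]] is generated by the powers of [alpha]. Starting from 0, each
    term [m * alpha ^+ j] is reached by adding or subtracting [alpha ^+ j] repeatedly. *)
Lemma represents_int_set S alpha :
  S `<=` @int_set R -> adjoin_set S alpha 0 ->
  (forall z j, adjoin_set S alpha z ->
     adjoin_set S alpha (z + alpha ^+ j) /\
     adjoin_set S alpha (z - alpha ^+ j)) ->
  represents S alpha.
Proof.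
move=> SZ S0 Sadd; apply/seteqP; split=> z; last first.
  by move=> [n [f [fS ->]]]; exists n, f; split=> // j; exact/SZ/fS.
have addn (m : nat) j w : adjoin_set S alpha w ->
    adjoin_set S alpha (w + m%:R * alpha ^+ j) /\
    adjoin_set S alpha (w - m%:R * alpha ^+ j).
  move=> Sw; elim: m => [|m [IHp IHm]]; first by rewrite mul0r subr0 addr0.
  rewrite -natr1 mulrDl mul1r opprD !addrA; split.
    by case: (Sadd _ j IHp).
  by case: (Sadd _ j IHm).
move=> /adjoin_setP [n [f [fZ ->]]]; move: n.+1 fZ => {z}n fZ.
elim: n fZ => [|n IH] fZ; first by rewrite big_geq.
rewrite big_nat_recr //=.
have {IH}/addn IH : adjoin_set S alpha (\sum_(0 <= j < n) f j * alpha ^+ j).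
  by apply: IH => j jn; apply: fZ; rewrite (leq_trans jn).
have [[m|m] _ <-] := fZ n (ltnSn n).
  by case: (IH m n).
by case: (IH m.+1 n) => _; rewrite NegzE rmorphN mulNr.
Qed.

Lemma represents_mem S alpha s : represents S alpha -> S s ->
  exists p, s = (ZC p).[alpha].
Proof.
by move=> rS /(adjoin_set_const _ alpha); rewrite -rS => /adjoin_int_setP.
Qed.

Lemma represents_int S alpha (m : int) :
  represents S alpha -> adjoin_set S alpha m%:~R.
Proof.
by move=> <-; apply/adjoin_int_setP; exists m%:P; rewrite map_polyC hornerC.
Qed.

(** * Roots of unity *)

Lemma norm_unity_root n alpha : (0 < n)%N -> alpha ^+ n = 1 -> `|alpha| = 1.
Proof.
move=> n0 an; apply/eqP; rewrite -(@pexpr_eq1 _ _ n) //.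
by rewrite -normrX an normr1.
Qed.

Lemma represents_binary n alpha : (0 < n)%N -> alpha ^+ n = 1 -> alpha != 1 ->
  represents [set 0; 1] alpha.
Proof.
move=> n0 an a1; set S := [set 0; 1]; have S0 : adjoin_set S alpha 0.
  by apply: adjoin_set_const; left.
have Sadd z j : adjoin_set S alpha z -> adjoin_set S alpha (z + alpha ^+ j).
  move=> /adjoin_setP [m [f [fS ->]]].
  (* [J] is congruent to [j] modulo [n] and lies beyond the last exponent [m], so a digit 1 can be
     placed there, with zeros in between. *)
  pose J := (n * m.+1 + j)%N.
  have aJ : alpha ^+ J = alpha ^+ j by rewrite exprD exprM an expr1n mul1r.
  have mJ : (m.+1 <= J)%N by rewrite /J -[m.+1]addn0 leq_add // addn0 leq_pmull.
  apply/adjoin_setP; exists J, (fun i => if (i < m.+1)%N then f i else (i == J)%:R).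
  split=> [i _|].
    by case: ifP => [/fS //|_]; case: (i == J); [right|left].
  rewrite [RHS](big_cat_nat (n := m.+1)) ?(leqW mJ) //=.
  rewrite [X in _ = _ + X]big_nat_recr //= (ltnNge J) mJ /= eqxx mul1r aJ.
  congr (_ + _); first by apply: eq_big_nat => i /andP[_ ->].
  rewrite big_nat big1 ?add0r // => i /andP[mi iJ].
  by rewrite ltnNge mi /= ltn_eqF // mul0r.
have sum0 : \sum_(i < n) alpha ^+ i = 0.
  have /eqP := subrX1 alpha n; rewrite an subrr eq_sym mulf_eq0 subr_eq0.
  by rewrite (negPf a1) => /eqP.
apply: represents_int_set => // [_ [->|->]|z j Sz]; first by exists 0.
  by exists 1.
split; first exact: Sadd.
(* Multiplying [sum0] by [alpha ^+ j] turns the subtraction into [n.-1] additions of powers. *)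
have -> : - alpha ^+ j = \sum_(0 <= i < n.-1) alpha ^+ (i.+1 + j).
  apply/esym/eqP; rewrite -addr_eq0 addrC.
  have := congr1 (fun x => alpha ^+ j * x) sum0.
  rewrite -[in LHS](prednK n0) big_ord_recl mulr0 mulrDr mulr1 mulr_sumr => {2}<-.
  rewrite big_mkord; apply/eqP; congr (_ + _).
  by apply: eq_bigr => i _; rewrite -exprD addnC.
elim: (n.-1) => [|k IH]; first by rewrite big_geq ?addr0.
by rewrite big_nat_recr //= addrA; apply: Sadd.
Qed.

(** All powers of 1 coincide, so adding a digit amounts to appending it at the next exponent; 0
    arises as [1 - 1]. *)
Lemma represents_signs : represents [set 1; -1] (1 : R[i]).
Proof.
set S := [set 1; -1].
have Sadd z s : adjoin_set S 1 z -> S s -> adjoin_set S 1 (z + s).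
  move=> /adjoin_setP [m [f [fS ->]]] Ss.
  apply/adjoin_setP; exists m.+1, (fun i => if (i < m.+1)%N then f i else s).
  split=> [i _|]; first by case: ifP => [/fS|].
  rewrite [RHS]big_nat_recr //= ltnn expr1n mulr1; congr (_ + _).
  by apply: eq_big_nat => i /andP[_ ->].
apply: represents_int_set => [_ [->|->]||z j Sz].
- by exists 1.
- by exists (-1).
- rewrite -(subrr 1); apply: Sadd; last by right.
  by apply: adjoin_set_const; left.
- by rewrite expr1n; split; apply: Sadd => //; [left|right].
Qed.

Lemma not_represents_set1 n alpha s : (0 < n)%N -> alpha ^+ n = 1 ->
  ~ represents [set s] alpha.
Proof.
move=> n0 an rS.
have rep (m : int) : exists k, m%:~R = s * \sum_(j < k.+1) alpha ^+ j.
  have [k [f [fs ->]]] := represents_int _ _ m rS.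
  by exists k; rewrite mulr_sumr; apply: eq_bigr => j _; rewrite (fs j).
(* For [alpha = 1] the sums are positive multiples of [s]: representing 0 forces [s = 0], and then 1
   is missed. *)
have [a1|a1] := eqVneq alpha 1.
  have [k0 /esym/eqP] := rep 0; have [k1] := rep 1.
  have sum1 k : \sum_(j < k) alpha ^+ j = k%:R.
    by rewrite (eq_bigr (fun=> 1)) ?sumr_const ?card_ord // => j; rewrite a1 expr1n.
  rewrite !sum1 mulf_eq0 pnatr_eq0 orbF => + /eqP s0.
  by rewrite s0 mul0r => /eqP; rewrite oner_eq0.
(* Every sum equals [s * (alpha ^+ l.+1 - 1) / (alpha - 1)], of modulus at most
   [2 * |s| / |alpha - 1|]; the integer [k] exceeds this bound. *)
have [k hk] : exists k : nat, `|s| * 2 < k%:R * `|alpha - 1|.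
  by apply: exists_nat_mul_gt; rewrite ?normr_gt0 ?subr_eq0 // mulr_ge0.
have [l kE] := rep k; move: hk; rewrite -[k%:R]normr_nat -normrM.
have -> : k%:R * (alpha - 1) = s * (alpha ^+ l.+1 - 1).
  by rewrite -[k%:R]/(k%:~R) kE subrX1 -mulrA [(_ - 1) * _]mulrC.
rewrite normrM real_ltNge ?rpredM ?normr_real ?realn //.
rewrite ler_wpM2l // (le_trans (ler_normB _ _)) // normrX normr1.
by rewrite (norm_unity_root _ _ n0 an) expr1n.
Qed.

Lemma set2_card2 (T : Type) (a b : T) : a <> b -> ([set a; b] #= `I_2)%card.
Proof.
move=> ab; apply/eq_cardSP; exists a; first by left.
suff -> : [set a; b] `\ a = [set b] by exact: card_set1.
apply/seteqP; split=> x; first by case=> -[->|] // [].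
by move=> ->; split; [right|move=> ba; apply: ab].
Qed.

Lemma card1_set1 (T : Type) (S : set T) :
  (S #= `I_1)%card -> exists a, S = [set a].
Proof.
move=> /eq_cardSP [a Sa]; rewrite II0 card_eq0 => /eqP Sa0; exists a.
apply/seteqP; split=> [x Sx /=|_ -> //]; apply: contrapT => xa.
by have : set0 x by rewrite -Sa0.
Qed.

Lemma card2_set2 (T : Type) (S : set T) :
  (S #= `I_2)%card -> exists a b, S = [set a; b].
Proof.
move=> /eq_cardSP [a Sa] /card1_set1 [b Sb]; exists a, b.
apply/seteqP; split=> [x Sx|x [->//|->]].
  by have [->|xa] := pselect (x = a); [left|right; rewrite -Sb].
by have [] : (S `\ a) b by rewrite Sb.
Qed.

Lemma root_of_unity_FN2 alpha : is_root_of_unity alpha -> FN 2 alpha.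
Proof.
move=> [n n0 /unity_rootP an]; split.
- exists ('X^n - 1); first by rewrite monic_neq0 // monicXnsubC.
  by rewrite rmorphB /= map_polyXn rmorph1 /root !hornerE an subrr.
- have [->|a1] := eqVneq alpha 1.
    exists [set 1; -1]; split; last exact: represents_signs.
    apply: set2_card2 => /eqP; rewrite -subr_eq0 opprK.
    by rewrite -[1 + 1]/(2%:R) pnatr_eq0.
  exists [set 0; 1]; split; last exact: represents_binary an a1.
  by apply: set2_card2 => /eqP; rewrite eq_sym oner_eq0.
(* An expansion has at least one digit, so the empty set does not even represent 0. *)
- move=> S [|[|//]] cS rS.
    move: cS; rewrite II0 card_eq0 => /eqP S0; have := represents_int _ _ 0 rS.
    by move=> [m [f [fS _]]]; have := fS ord0; rewrite S0.
  have [s SE] := card1_set1 _ _ cS.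
  by case: (not_represents_set1 n alpha s n0 an); rewrite -SE.
Qed.

(** * Conjugates *)

Section Conjugates.
Variables (alpha : R[i]) (M : {poly int}).
Hypothesis minM : is_primitive_minpoly alpha M.

Lemma minpoly_neq0 : M != 0.
Proof.
by have [+ _ _] := minM; apply: contra_eqN => /eqP ->; rewrite zcontents0.
Qed.

Lemma minpoly_lead_coef_gt0 : 0 < lead_coef M.
Proof. by have [cM _ _] := minM; rewrite -sgz_gt0 -sgz_contents cM. Qed.

Lemma minpoly_rat_neq0 : ZQ M != 0.
Proof.
by rewrite map_poly_eq0_id0 ?minpoly_neq0 // intr_eq0 gt_eqF ?minpoly_lead_coef_gt0.
Qed.

Lemma minpoly_dvd (p : {poly rat}) : root (QC p) alpha -> ZQ M %| p.
Proof.
move=> rp; have [_ rM Mmin] := minM; rewrite -/(p %% ZQ M == 0).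
apply/negPn/negP => rem0.
have := ltn_modp p (ZQ M); rewrite minpoly_rat_neq0 ltnNge => /negP; apply.
rewrite size_map_inj_poly //; last exact: intr_inj.
apply: (Mmin _ rem0).
have : root (QC (p %/ ZQ M * ZQ M + p %% ZQ M)) alpha by rewrite -divp_eq.
rewrite rmorphD rmorphM /= map_ratr_intr /root !hornerE.
by rewrite (eqP rM) mulr0 add0r.
Qed.

(** Gauss's lemma: since [M] is primitive, divisibility over the rationals descends to the
    integers. *)
Lemma minpoly_dvd_int p : root (ZC p) alpha -> exists q, p = M * q.
Proof.
rewrite -map_ratr_intr => /minpoly_dvd; rewrite dvdp_rat_int => /dvdpP_int [q ->].
by have [cM _ _] := minM; exists q; rewrite {2}[M]zpolyEprim cM scale1r.
Qed.

Lemma root_transfer p beta : root (ZC M) beta -> root (ZC p) alpha ->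
  root (ZC p) beta.
Proof.
by move=> rb /minpoly_dvd_int [q ->]; rewrite rmorphM rootM rb.
Qed.

(** This makes the substitution of [beta] for [alpha] well defined on [Z[alpha]]. *)
Lemma horner_transfer p q beta : root (ZC M) beta ->
  (ZC p).[alpha] = (ZC q).[alpha] -> (ZC p).[beta] = (ZC q).[beta].
Proof.
move=> rb pq; have := root_transfer (p - q) beta rb.
rewrite rmorphB /= /root !hornerE pq subrr eqxx => /(_ isT).
by rewrite subr_eq0 => /eqP.
Qed.

(** Irreducibility of [M]: the gcd [g] of [M] and [p] is not constant, as it vanishes at [beta]. The
    cofactor [h] then has degree below that of [M], so it cannot vanish at [alpha]; hence [g] does,
    and so does [p]. *)
Lemma root_transfer_conj p beta : root (ZC M) beta -> root (ZC p) beta ->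
  root (ZC p) alpha.
Proof.
move=> rMb rpb; have [_ rM Mmin] := minM.
pose g := gcdp (ZQ M) (ZQ p).
have rg : root (QC g) beta.
  by rewrite gcdp_map !map_ratr_intr root_gcd rMb.
have gp : root (QC g) alpha -> root (ZC p) alpha.
  by rewrite gcdp_map !map_ratr_intr root_gcd => /andP[].
have MQ0 := minpoly_rat_neq0.
have /dvdpP [h hE] : g %| ZQ M by exact: dvdp_gcdl.
clearbody g.
have h0 : h != 0 by apply: contraNneq MQ0 => h0; rewrite hE h0 mul0r.
have g0 : g != 0 by apply: contraNneq MQ0 => g0; rewrite hE g0 mulr0.
have g1 : (1 < size g)%N.
  rewrite -(size_map_poly (ratr : {rmorphism rat -> R[i]})).
  by apply: root_size_gt1 rg; rewrite map_poly_eq0.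
have sM : size M = (size h + size g).-1.
  by rewrite -size_mul // -hE size_map_inj_poly //; exact: intr_inj.
move: rM; rewrite -map_ratr_intr hE rmorphM rootM => /orP[rh|]; last exact: gp.
exfalso; have := Mmin h h0 rh; rewrite sM; case: (size g) g1 => [|[|k]] // _.
by rewrite !addnS /= ltnNge leq_addr.
Qed.

Lemma conj_inv : ~~ root (ZC M) 0 ->
  (exists2 beta, root (ZC M) beta & `|beta| = 1) ->
  forall gamma, root (ZC M) gamma -> root (ZC M) gamma^-1.
Proof.
move=> M0 [beta rb nb] gamma rg; pose d := (size M).-1.
have sM : size M = d.+1 by rewrite prednK // size_poly_gt0 minpoly_neq0.
(* The reciprocal polynomial of [M]; its nonzero roots are the inverses of those of [M]. *)
pose M' : {poly int} := \poly_(i < d.+1) M`_(d - i).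
have M'E (x : R[i]) : x != 0 -> (ZC M').[x] = x ^+ d * (ZC M).[x^-1].
  move=> x0; rewrite (@horner_coef_wide _ d.+1); last first.
    exact: leq_trans (size_poly _ _) (size_poly _ _).
  rewrite (@horner_coef_wide _ d.+1 (ZC M)); last first.
    by rewrite -sM size_poly.
  rewrite mulr_sumr (reindex_inj rev_ord_inj); apply: eq_bigr => i _.
  have id : (i <= d)%N by rewrite -ltnS.
  rewrite !coef_map coef_poly /= subSS ltnS leq_subr subKn // mulrCA.
  congr (_ * _); apply: (mulIf (expf_neq0 i x0)).
  by rewrite -exprD subnK // exprVn mulfVK // expf_neq0.
have nz x : root (ZC M) x -> x != 0 by move=> rx; apply: contraNneq M0 => <-.
have rbV : root (ZC M) beta^-1.
  rewrite invC_norm nb expr1n invr1 mul1r.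
  have -> : ZC M = map_poly Num.conj (ZC M).
    by apply/polyP => i; rewrite !coef_map /= rmorph_int.
  by rewrite rootE horner_map fmorph_eq0.
(* The vanishing of [M'] passes from [beta] to [alpha] and from there to [gamma]. *)
have /(root_transfer_conj _ _ rb) /(root_transfer _ _ rg) : root (ZC M') beta.
  by rewrite rootE M'E ?nz // (eqP rbV) mulr0.
rewrite rootE M'E ?nz // mulf_eq0 expf_eq0 (negPf (nz _ rg)) andbF /=.
by rewrite -rootE.
Qed.

(** By factoring over the complex numbers, [|M(0)|] is the leading coefficient times the product of
    the moduli of the roots, a nonempty product of factors above 1. *)
Lemma minpoly_horner0_gt :
  (forall beta, root (ZC M) beta -> 1 < `|beta|) -> lead_coef M < `|M.[0]|.
Proof.
have [_ rM _] := minM => big; have lM := minpoly_lead_coef_gt0.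
have [rs rsE] := closed_field_poly_normal (ZC M).
have lE : lead_coef (ZC M) = (lead_coef M)%:~R.
  by rewrite lead_coef_map_inj //; exact: intr_inj.
have lM0 : lead_coef (ZC M) != 0 by rewrite lE intr_eq0 gt_eqF.
have rrs z : root (ZC M) z = (z \in rs).
  by rewrite rsE rootZ // root_prod_XsubC.
have rs0 : rs != [::] by apply: contraTneq rM => rs0; rewrite rrs rs0.
have n0E : `|(ZC M).[0]| = (lead_coef M)%:~R * \prod_(z <- rs) `|z|.
  rewrite rsE hornerZ normrM lE horner_prod normr_prod; congr (_ * _).
    by rewrite -intr_norm gtr0_norm.
  by apply: eq_bigr => z _; rewrite !hornerE normrN.
rewrite -(ltr_int R[i]) intr_norm -horner_map rmorph0.
rewrite n0E ltr_pMr ?ltr0z //.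
have {}big z : z \in rs -> 1 < `|z| by rewrite -rrs; exact: big.
case: rs rs0 big {rsE rrs n0E} => // x rs _ big; rewrite big_cons.
apply: lt_le_trans (big x (mem_head _ _)) _; rewrite ler_peMr //.
rewrite big_seq; elim/big_ind : _ => // [a b a1 b1|z zrs].
  by rewrite -[1]mulr1 ler_pM.
by apply/ltW/big; rewrite in_cons zrs orbT.
Qed.

(** * Constraints imposed by two digits *)

(** The digits themselves lie in [Z[alpha]]. Fixing polynomials [p] and [q] for them allows
    expansions to be evaluated at a conjugate. *)
Lemma represents2_poly a b : represents [set a; b] alpha ->
  exists p q : {poly int}, forall m : int, exists n (f : nat -> {poly int}),
    (forall j, f j = p \/ f j = q) /\
    m%:~R = \sum_(0 <= j < n.+1) (ZC (f j)).[alpha] * alpha ^+ j.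
Proof.
move=> rS; have [p pE] := represents_mem _ _ a rS (or_introl erefl).
have [q qE] := represents_mem _ _ b rS (or_intror erefl).
exists p, q => m; have /adjoin_setP[n [f [fS ->]]] := represents_int _ _ m rS.
exists n, (fun j => if f j == a then p else q); split=> [j|].
  by case: ifP; [left|right].
apply: eq_big_nat => j /andP[_ /fS fj]; congr (_ * _).
case: eqVneq => [-> //|fa]; case: fj => [/eqP|->//].
by rewrite (negPf fa).
Qed.

Lemma represents2_norm_ge1 a b beta : represents [set a; b] alpha ->
  root (ZC M) beta -> 1 <= `|beta|.
Proof.
move=> /represents2_poly [p [q rep]] rb.
rewrite real_leNgt ?normr_real ?real1 //; apply/negP => b1.
pose C := `|(ZC p).[beta]| + `|(ZC q).[beta]|.
have C0 : 0 <= C by rewrite addr_ge0.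
(* [k] exceeds [C / (1 - |beta|)], the geometric series bound for any expansion evaluated at
   [beta]. *)
have [k hk] : exists k : nat, C < k%:R * (1 - `|beta|).
  by apply: exists_nat_mul_gt; rewrite ?subr_gt0.
have [n [f [fpq kE]]] := rep k.
have {}kE : k%:R = \sum_(0 <= j < n.+1) (ZC (f j)).[beta] * beta ^+ j.
  have hE x : (ZC (\sum_(0 <= j < n.+1) f j * 'X^j)).[x] =
              \sum_(0 <= j < n.+1) (ZC (f j)).[x] * x ^+ j.
    rewrite rmorph_sum horner_sum; apply: eq_bigr => j _.
    by rewrite rmorphM /= map_polyXn hornerM hornerXn.
  rewrite -hE -(horner_transfer k%:Z%:P _ beta rb).
    by rewrite map_polyC hornerC.
  by rewrite map_polyC hornerC hE.
suff : k%:R * (1 - `|beta|) <= C by move=> /(lt_le_trans hk); rewrite ltxx.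
have kC : k%:R <= C * \sum_(j < n.+1) `|beta| ^+ j.
  rewrite -[k%:R]normr_nat kE big_mkord (le_trans (ler_norm_sum _ _ _)) // mulr_sumr.
  apply: ler_sum => j _; rewrite normrM normrX ler_wpM2r ?exprn_ge0 //.
  by have [->|->] := fpq j; rewrite ?lerDl ?lerDr.
have d0 : 0 <= 1 - `|beta| by rewrite subr_ge0 ltW.
apply: le_trans (ler_wpM2r d0 kC) _.
rewrite -mulrA [_ * (1 - _)]mulrC -opprB mulNr -subrX1 opprB.
by rewrite ler_piMr // gerBl exprn_ge0.
Qed.

(** Pigeonhole: among 0, 1, 2 two integers share their constant digit, so [alpha] divides their
    difference in [Z[alpha]]. *)
Lemma represents2_horner0 a b : represents [set a; b] alpha ->
  exists2 m : int, 1 <= m <= 2 & (M.[0] %| m)%Z.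
Proof.
move=> /represents2_poly [p [q rep]].
have {}rep (m : int) : exists (e : bool) w,
    m%:~R = (ZC (if e then p else q)).[alpha] + alpha * (ZC w).[alpha].
  have [n [f [fpq ->]]] := rep m.
  have [e eE] : exists e : bool, f 0%N = if e then p else q.
    by case: (fpq 0%N) => ->; [exists true|exists false].
  exists e, (\sum_(0 <= j < n) f j.+1 * 'X^j).
  rewrite big_nat_recl // mulr1 -eE; congr (_ + _).
  rewrite rmorph_sum horner_sum mulr_sumr; apply: eq_bigr => j _.
  by rewrite rmorphM /= map_polyXn hornerM hornerXn exprS mulrCA.
have dvd (m1 m2 : int) r w1 w2 :
    m1%:~R = (ZC r).[alpha] + alpha * (ZC w1).[alpha] ->
    m2%:~R = (ZC r).[alpha] + alpha * (ZC w2).[alpha] -> (M.[0] %| m2 - m1)%Z.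
  move=> E1 E2.
  (* This polynomial is a multiple of [M]; evaluating at 0 leaves [m2 - m1] as a multiple of
     [M(0)]. *)
  have /minpoly_dvd_int [h hE] : root (ZC ((m2 - m1)%:P - 'X * (w2 - w1))) alpha.
    rewrite rootE !(rmorphB, rmorphM) /= map_polyX !map_polyC /= !hornerE E1 E2.
    rewrite mulrBr opprD addrACA subrr add0r subrr.
    exact: eqxx.
  have := congr1 (horner^~ 0) hE; rewrite !hornerE => ->.
  exact: dvdz_mulr.
have [e0 [w0 E0]] := rep 0; have [e1 [w1 E1]] := rep 1; have [e2 [w2 E2]] := rep 2.
have [e01|e01] := eqVneq e0 e1.
  by exists 1 => //; rewrite -(subr0 1); apply: dvd E0 _; rewrite e01; exact: E1.
have [e12|e12] := eqVneq e1 e2.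
  exists 1 => //; rewrite -[1]/(2 - 1 : int); apply: dvd E1 _.
  by rewrite e12; exact: E2.
exists 2 => //; rewrite -(subr0 2); apply: dvd E0 _.
suff -> : e0 = e2 by exact: E2.
by case: e0 e1 e2 e01 e12 {E1 E2} => [] [] [].
Qed.

End Conjugates.

(** * The dichotomy for two digits *)

Lemma FN2_conjugates alpha : FN 2 alpha ->
  (forall beta, conjugates alpha beta -> `|beta| = 1) \/
  (expanding_algebraic_integer alpha /\ `|(primitive_minpoly alpha).[0]| = 2).
Proof.
move=> [/primitive_minpolyP minM [S [/card2_set2 [a [b ->]] rS]] _].
rewrite /expanding_algebraic_integer /conjugates /=.
set M := primitive_minpoly alpha in minM *.
have ge1 beta : root (ZC M) beta -> 1 <= `|beta|.
  exact: represents2_norm_ge1 minM _ _ _ rS.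
have M0 : ~~ root (ZC M) 0.
  by apply/negP => /ge1; rewrite normr0 ler10.
have [[beta rb nb]|no1] := pselect (exists2 beta, root (ZC M) beta & `|beta| = 1).
  left=> gamma rg; apply/eqP; rewrite eq_le ge1 // andbT.
  have /ge1 : root (ZC M) gamma^-1.
    by apply: conj_inv minM M0 _ _ rg; exists beta.
  rewrite normfV invf_ge1 // normr_gt0.
  by apply: contraNneq M0 => <-.
right; have gt1 beta : root (ZC M) beta -> 1 < `|beta|.
  move=> rb; rewrite lt_neqAle ge1 // andbT; apply/eqP => nb.
  by apply: no1; exists beta.
have [m m12 dM] := represents2_horner0 _ _ minM _ _ rS.
have lt0 := minpoly_horner0_gt _ _ minM gt1.
have lM := minpoly_lead_coef_gt0 _ _ minM.
have le2 : `|M.[0]| <= 2.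
  move/andP: m12 => [m1 m2]; apply: le_trans m2.
  have m0 : 0 < m by exact: lt_le_trans m1.
  rewrite -[X in _ <= X]gtr0_norm // -!abszE lez_nat dvdn_leq ?absz_gt0 ?gt_eqF //.
(* The integers satisfy [0 < lead_coef M < |M(0)| <= 2], which leaves only 1 and 2. *)
have lc1 : lead_coef M = 1.
  apply/eqP; rewrite eq_le -ltzD1 (lt_le_trans lt0) //=.
have n2 : `|M.[0]| = 2.
  by apply/eqP; rewrite eq_le le2 /=; move: lt0; rewrite lc1.
split=> //; split=> //; exists M; first by rewrite monicE lc1.
by have [] := minM.
Qed.

End Theorem2.

Theorem theorem2 (R : realType) :
  (forall alpha : R[i], is_root_of_unity alpha -> FN 2 alpha) /\
  (forall alpha : R[i], FN 2 alpha ->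
     (forall beta : R[i], conjugates alpha beta -> `|beta| = 1) \/
     (expanding_algebraic_integer alpha /\
      `|(primitive_minpoly alpha).[0]| = 2)).
Proof. by split; [exact: root_of_unity_FN2|exact: FN2_conjugates]. Qed.
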